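(* In every instance of fair division with market values with two agents and at most six goods (with additive subjective utilities and additive market valuation), there exists an allocation that is SD-EF1 both with respect to the subjective utilities and with respect to the market valuation.
   Context: An instance of fair division with market values $\langle \mathcal{N}, \mathcal{M}, v, (u_i)_{i\in\mathcal{N}}\rangle$ consists of a finite set $\mathcal{N}$ of $n$ agents, a finite set $\mathcal{M}$ of $m$ indivisible goods, a market valuation $v:2^{\mathcal{M}}\to\mathbb{R}_{\ge 0}$, and a subjective utility function $u_i:2^{\mathcal{M}}\to\mathbb{R}_{\ge 0}$ for each agent $i$. Here all these set functions are additive: $f(S)=\sum_{g\in S} f(\{g\})$ for all $S\subseteq\mathcal{M}$, with $f(\emptyset)=0$; write $f(g)=f(\{g\})$. An allocation $A=(A_1,\dots,A_n)$ is a partition of $\mathcal{M}$ into $n$ pairwise disjoint (possibly empty) bundles, with $A_i$ given to agent $i$ and $\bigcup_i A_i=\mathcal{M}$. SD-preference: for an additive $f$ and $X,Y\subseteq\mathcal{M}$, write $X \succcurlyeq^{\mathsf{SD}}_{f} Y$ if for each good $g\in\mathcal{M}$, $|\{g'\in X: f(g')\ge f(g)\}|\ge |\{g'\in Y: f(g')\ge f(g)\}|$. $A$ is SD-EF1 with respect to the subjective utilities if for every $i,j\in\mathcal{N}$, either $A_j=\emptyset$ or $A_i\succcurlyeq^{\mathsf{SD}}_{u_i} A_j\setminus\{g\}$ for some $g\in A_j$. $A$ is SD-EF1 with respect to the market valuation if the same holds with every $u_i$ replaced by $v$. *)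

(* Defs.v *)
From HB Require Import structures.
From mathcomp Require Import all_boot all_order all_algebra.
From mathcomp Require Import reals.

Set Implicit Arguments.
Unset Strict Implicit.
Unset Printing Implicit Defensive.

Import Order.TTheory GRing.Theory Num.Theory.
Local Open Scope ring_scope.

Definition nonneg_setfun (R : realType) (M : finType) (f : {set M} -> R) : Prop :=
  forall S : {set M}, 0 <= f S.

Definition additive_setfun (R : realType) (M : finType) (f : {set M} -> R) : Prop :=
  f set0 = 0 /\ forall S : {set M}, f S = \sum_(g in S) f [set g].

Definition is_allocation (N M : finType) (A : N -> {set M}) : Prop :=
  (forall i j : N, i != j -> [disjoint A i & A j]) /\
  \bigcup_(i : N) A i = [set: M].

Definition SD_pref (R : realType) (M : finType) (f : {set M} -> R)
    (X Y : {set M}) : Prop :=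
  forall g : M,
    (#|[set g' in X | (f [set g'] >= f [set g])%R]| >=
     #|[set g' in Y | (f [set g'] >= f [set g])%R]|)%N.

(* [w i] is the set function with which agent [i] compares bundles: SD-EF1 with
   respect to the market valuation [v] is the case [w := fun _ => v]. *)
Definition SD_EF1 (R : realType) (N M : finType) (w : N -> {set M} -> R)
    (A : N -> {set M}) : Prop :=
  forall i j : N,
    A j = set0 \/ exists2 g : M, g \in A j & SD_pref (w i) (A i) (A j :\ g).

(* Main.v *)
Require Import Defs.
From HB Require Import structures.
From mathcomp Require Import all_boot all_order all_algebra.
From mathcomp Require Import reals.

Set Implicit Arguments.
Unset Strict Implicit.
Unset Printing Implicit Defensive.

Import Order.TTheory GRing.Theory Num.Theory.
Local Open Scope ring_scope.

(** Breaking ties turns each valuation into a ranking of the goods, and an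
    allocation is SD-EF1 for agent [i] as soon as, in every prefix of [i]'s
    ranking, the other agent holds at most one good more than [i].
    Number the goods by market rank.  Any allocation splitting each of the pairs
    {0,1}, {2,3}, {4,5} is SD-EF1 for the market; there are 8 of them.  For a
    given ranking such an allocation is bad only if the other agent gets both of
    the top two goods, or the agent gets both of the bottom two: each event
    excludes at most 2 of the 8 allocations, and if both exclude exactly 2 they
    overlap.  So each agent accepts at least 5 of the 8, and some allocation is
    accepted by both.  Fewer than six goods are padded with dummies of lowest
    rank. *)

Definition prefix_fair (o : pred nat) (t : seq nat) : bool :=
  all (fun k => count (predC o) (take k t) <= (count o (take k t)).+1)%N
    (iota 0 (size t).+1).

(** Ranks [2i] and [2i+1] share the bit at index [r./2] but differ in parity, so exactly one of them
    satisfies the predicate. *)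
Definition splitting (b : bool * bool * bool) : pred nat := fun r =>
  odd r (+) nth false [:: b.1.1; b.1.2; b.2] r./2.

Definition splittings : seq (bool * bool * bool) :=
  let bs := [:: false; true] in
  [seq (x, z) | x <- [seq (x, y) | x <- bs, y <- bs], z <- bs].

(** Checked by evaluation on all 720 rankings. The second count serves the agent who receives the
    complement. *)
Lemma most_splittings_prefix_fair (t : seq nat) : perm_eq t (iota 0 6) ->
  (5 <= count (fun b => prefix_fair (splitting b) t) splittings)%N /\
  (5 <= count (fun b => prefix_fair (predC (splitting b)) t) splittings)%N.
Proof.
pose ok s :=
  (4 < count (fun b => prefix_fair (splitting b) s) splittings)%N &&
  (4 < count (fun b => prefix_fair (predC (splitting b)) s) splittings)%N.
have all_ok : all ok (permutations (iota 0 6)) by vm_compute.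
by rewrite -mem_permutations => /(allP all_ok) /andP.
Qed.

(** In market order each completed pair gives one good to either side, so only an unfinished pair
    can unbalance a prefix, and by one good. *)
Lemma splitting_prefix_fair_iota (b : bool * bool * bool) :
  prefix_fair (splitting b) (iota 0 6) /\
  prefix_fair (predC (splitting b)) (iota 0 6).
Proof. by move: b => [[[] []] []]; split; vm_compute. Qed.

Lemma common_prefix_fair (t1 t2 : seq nat) :
    perm_eq t1 (iota 0 6) -> perm_eq t2 (iota 0 6) ->
  exists o : pred nat,
    [/\ prefix_fair o t1, prefix_fair (predC o) t2,
        prefix_fair o (iota 0 6) & prefix_fair (predC o) (iota 0 6)].
Proof.
move=> /most_splittings_prefix_fair [le5_1 _].
move=> /most_splittings_prefix_fair [_ le5_2].
have /hasP[b _ /andP[fair1 fair2]] :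
    has (predI (fun b => prefix_fair (splitting b) t1)
               (fun b => prefix_fair (predC (splitting b)) t2)) splittings.
  (* Inclusion-exclusion: the two counts total at least 10, while the union has at most 8
     elements. *)
  rewrite has_count -(ltn_add2l (count (predU
    (fun b => prefix_fair (splitting b) t1)
    (fun b => prefix_fair (predC (splitting b)) t2)) splittings)).
  rewrite addn0 count_predUI (leq_trans _ (leq_add le5_1 le5_2)) //.
  by rewrite !ltnS (leq_trans (count_size _ _)).
by have [fairv fairvC] := splitting_prefix_fair_iota b; exists (splitting b).
Qed.

Section Ranking.

Context (R : realType) (M : finType).
Implicit Types (f : M -> R) (s : seq M) (X Y : {set M}).

Definition ranking f : seq M := sort (fun x y => f y <= f x) (enum M).

Lemma mem_ranking f x : x \in ranking f.
Proof. by rewrite mem_sort mem_enum. Qed.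

Lemma ranking_uniq f : uniq (ranking f).
Proof. by rewrite sort_uniq enum_uniq. Qed.

Lemma size_ranking f : size (ranking f) = #|M|.
Proof. by rewrite size_sort cardE. Qed.

(** Values decrease along the ranking, so once a good falls below [c] all later ones do. *)
Lemma filter_ranking f (c : R) :
  exists2 k, (k <= #|M|)%N & [seq x <- ranking f | c <= f x] = take k (ranking f).
Proof.
have ge_trans : transitive (fun x y => f y <= f x).
  by move=> y x z le_yx le_zy; apply: le_trans le_zy le_yx.
exists (count (fun x => c <= f x) (ranking f)).
  by rewrite -(size_ranking f) count_size.
have: sorted (fun x y => f y <= f x) (ranking f).
  by apply: sort_sorted => x y; apply: le_total.
elim: (ranking f) => //= x s IHs; rewrite path_sortedE // => /andP[ge_x sorted_s].
case: ifP => [_ | lt_xc]; first by rewrite IHs.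
have /eqP -> : count (fun y => c <= f y) s == 0%N.
  rewrite eqn0Ngt -has_count; apply/hasPn => y /(allP ge_x) le_yx.
  by apply: contraFN lt_xc => /le_trans; apply.
apply/eqP; rewrite -[_ == _]negbK -has_filter; apply/hasPn => y.
move=> /(allP ge_x) le_yx.
by apply: contraFN lt_xc => /le_trans; apply.
Qed.

Lemma card_upper_ranking f X (c : R) :
  #|[set x in X | c <= f x]| = count (mem X) [seq x <- ranking f | c <= f x].
Proof.
rewrite -size_filter -filter_predI cardE.
apply/perm_size/uniq_perm; rewrite ?enum_uniq ?filter_uniq ?ranking_uniq //.
by move=> x; rewrite mem_enum mem_filter !inE mem_ranking andbT.
Qed.

(** The good removed is a most valued one of [Y]. At thresholds up to its value the removal absorbs
    the extra 1; above it, [Y] has no goods at all. *)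
Lemma SD_pref_ranking (f : {set M} -> R) X Y :
    (forall k, (k <= #|M|)%N ->
      count (mem Y) (take k (ranking (fun x => f [set x]))) <=
      (count (mem X) (take k (ranking (fun x => f [set x])))).+1)%N ->
  Y = set0 \/ exists2 g, g \in Y & SD_pref f X (Y :\ g).
Proof.
set f1 := fun x => f [set x] => fairXY.
have [-> | /set0Pn[y0 y0Y]] := eqVneq Y set0; [by left | right].
have [g Yg max_g] := arg_maxP f1 y0Y.
have gY : g \in Y := Yg; exists g => // h.
have [le_hg | lt_gh] := lerP (f1 h) (f1 g).
  have <- : [set x in Y | f1 h <= f1 x] :\ g
          = [set x in Y :\ g | f [set h] <= f [set x]].
    by apply/setP=> x; rewrite !inE andbA.
  rewrite -ltnS; apply: (@leq_trans #|[set x in Y | f1 h <= f1 x]|).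
    by rewrite [X in (_ <= X)%N](cardsD1 g) inE gY le_hg.
  rewrite !(card_upper_ranking f1).
  by have [k le_kM ->] := filter_ranking f1 (f1 h); apply: fairXY.
suff -> : [set x in Y :\ g | f [set h] <= f [set x]] = set0 by rewrite cards0.
apply/setP=> x; rewrite !inE; apply/negP => /andP[/andP[_ /max_g le_xg] le_hx].
by have := lt_le_trans lt_gh (le_trans le_hx le_xg); rewrite ltxx.
Qed.

(* The ranking [f] written in market ranks; the dummies are [#|M|, ..., n - 1]. *)
Definition market_ranks (n : nat) (v f : M -> R) : seq nat :=
  map (index^~ (ranking v)) (ranking f) ++ iota #|M| (n - #|M|).

Lemma market_ranks_self n (v : M -> R) : (#|M| <= n)%N ->
  market_ranks n v v = iota 0 n.
Proof.
move=> le_Mn; rewrite /market_ranks -{2}(add0n #|M|).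
suff -> : map (index^~ (ranking v)) (ranking v) = iota 0 #|M|.
  by rewrite -iotaD subnKC.
apply: (@eq_from_nth _ 0%N) => [|i]; rewrite size_map size_ranking ?size_iota //.
move=> lt_iM; have x0 : M := enum_val (Ordinal lt_iM).
by rewrite (nth_map x0) ?nth_iota ?index_uniq ?ranking_uniq ?size_ranking.
Qed.

Lemma market_ranks_perm n (v f : M -> R) : (#|M| <= n)%N ->
  perm_eq (market_ranks n v f) (iota 0 n).
Proof.
move=> le_Mn; rewrite -(market_ranks_self v le_Mn) perm_cat2r perm_map //.
by rewrite perm_sort perm_sym perm_sort perm_refl.
Qed.

(** Dummies come last, so prefixes of length at most [#|M|] contain only real goods. *)
Lemma prefix_fair_ranking n (v f : M -> R) (o : pred nat) X Y k :
    (#|M| <= n)%N -> (k <= #|M|)%N -> prefix_fair o (market_ranks n v f) ->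
    (forall x, (x \in X) = o (index x (ranking v))) ->
    (forall x, (x \in Y) = ~~ o (index x (ranking v))) ->
  (count (mem Y) (take k (ranking f)) <=
   (count (mem X) (take k (ranking f))).+1)%N.
Proof.
move=> le_Mn le_kM /allP/(_ k) fair defX defY.
have {fair} := fair _; rewrite takel_cat ?size_map ?size_ranking //.
rewrite -map_take !count_map (eq_count defX) (eq_count defY); apply.
rewrite mem_iota add0n ltnS (perm_size (market_ranks_perm v f le_Mn)).
by rewrite size_iota (leq_trans le_kM).
Qed.

End Ranking.

Theorem theorem2 (R : realType) (N M : finType)
    (v : {set M} -> R) (u : N -> {set M} -> R)
    (v_ge0 : nonneg_setfun v) (u_ge0 : forall i : N, nonneg_setfun (u i))
    (v_add : additive_setfun v) (u_add : forall i : N, additive_setfun (u i))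
    (two_agents : #|N| = 2%N) (six_goods : (#|M| <= 6)%N) :
  exists A : N -> {set M},
    is_allocation A /\ SD_EF1 u A /\ SD_EF1 (fun _ : N => v) A.
Proof.
have /eqP/cards2P[a [b [ab defN]]] : #|[set: N]| = 2%N by rewrite cardsT.
have agentP i : i = a \/ i = b.
  by have := in_setT i; rewrite defN !inE => /orP[] /eqP; [left | right].
pose val1 (f : {set M} -> R) x := f [set x].
have [o [fair_a fair_b]] := common_prefix_fair
  (market_ranks_perm (val1 v) (val1 (u a)) six_goods)
  (market_ranks_perm (val1 v) (val1 (u b)) six_goods).
(* The market order is the ranking of [v] in its own ranks, so [EF1] below covers both [u] and the
   constant family [v]. *)
rewrite -(market_ranks_self (val1 v) six_goods) => fair_v fair_vC.
pose X := [set x | o (index x (ranking (val1 v)))].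
pose A i := if i == a then X else ~: X.
have Aa : A a = X by rewrite /A eqxx.
have Ab : A b = ~: X by rewrite /A eq_sym (negPf ab).
have EF1 (w : N -> {set M} -> R) :
    prefix_fair o (market_ranks 6 (val1 v) (val1 (w a))) ->
    prefix_fair (predC o) (market_ranks 6 (val1 v) (val1 (w b))) ->
  SD_EF1 w A.
  move=> wa wb i j; apply: SD_pref_ranking => k le_kM.
  have [-> | ne_ij] := eqVneq i j; first exact: leqnSn.
  case: (agentP i) (agentP j) ne_ij => -> [] ->; rewrite ?eqxx // => _.
    by apply: (prefix_fair_ranking six_goods le_kM wa) => x; rewrite ?Aa ?Ab !inE.
  by apply: (prefix_fair_ranking six_goods le_kM wb) => x;
    rewrite ?Aa ?Ab !inE ?negbK.
exists A; split; last by split; apply: EF1.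
split=> [i j | ].
  case: (agentP i) (agentP j) => -> [] ->; rewrite ?eqxx // => _.
    by rewrite Aa Ab -setI_eq0 setICr.
  by rewrite Aa Ab -setI_eq0 setIC setICr.
apply/setP=> x; rewrite inE; apply/bigcupP.
have [xX | xX] := boolP (x \in X); first by exists a; rewrite ?Aa.
by exists b; rewrite ?Ab // in_setC.
Qed.
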